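(* For any pair of integers $a,b$ with $1\le a\le b\le 2a$, there exist a connected graph $G$ with $\gamma(G)=a$ and a function $f:V(G_1)\to V(G_2)$ such that $\gamma(C(G,f))=b$.
   Context: For disjoint copies $G_1,G_2$ of a graph $G$ and a function $f:V(G_1)\to V(G_2)$, the functigraph $C(G,f)$ has vertex set $V(G_1)\cup V(G_2)$ and edge set $E(G_1)\cup E(G_2)\cup\{uv : u\in V(G_1), v\in V(G_2), v=f(u)\}$. $\gamma(H)$ denotes the domination number of a graph $H$. *)

(* Defs.v *)
From mathcomp Require Import all_boot.

Set Implicit Arguments.
Unset Strict Implicit.
Unset Printing Implicit Defensive.

Record sgraph := SGraph {
  vertex :> finType;
  edge : rel vertex;
  edge_sym : symmetric edge;
  edge_irr : irreflexive edge }.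

Definition connected_graph (G : sgraph) : Prop :=
  0 < #|G| /\ forall x y : G, connect (@edge G) x y.

Definition dominating (G : sgraph) (D : {set G}) : bool :=
  [forall v, (v \in D) || [exists u in D, edge u v]].

(* The default [set: G] is itself dominating, so this is a genuine minimum:
   see dominationP. *)
Definition domination_number (G : sgraph) : nat :=
  #|[arg min_(D < [set: G] | dominating D) #|D|]|.

Lemma dominatingT (G : sgraph) : dominating [set: G].
Proof. by apply/forallP => v; rewrite inE. Qed.

Lemma dominationP (G : sgraph) :
  (exists2 D : {set G}, dominating D & #|D| = domination_number G) /\
  (forall D : {set G}, dominating D -> domination_number G <= #|D|).
Proof.
rewrite /domination_number; case: arg_minnP => [|D domD minD].
  exact: dominatingT.
by split=> //; exists D.
Qed.

Section Functigraph.

Variables (G : sgraph) (f : G -> G).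

(* G1 and G2 are the left and right summands of G + G; f : V(G1) -> V(G2) is
   given as a map on V(G) through the identification of each copy with G. *)
Definition functi_edge : rel (G + G)%type := fun x y =>
  match x, y with
  | inl u, inl v => edge u v
  | inr u, inr v => edge u v
  | inl u, inr v => v == f u
  | inr v, inl u => v == f u
  end.

Lemma functi_edge_sym : symmetric functi_edge.
Proof. by move=> [u|u] [v|v] //=; apply: edge_sym. Qed.

Lemma functi_edge_irr : irreflexive functi_edge.
Proof. by move=> [u|u] /=; apply: edge_irr. Qed.

Definition functigraph : sgraph := SGraph functi_edge_sym functi_edge_irr.

End Functigraph.

(* Main.v *)
(** Take a clique on [a] centres and hang two leaves, p and q, on each of them.
    Let [f] collapse the i-th star onto its leaf p for [b - a] of the stars and
    onto its centre for the others. All the centres of [G2], together with the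
    centres in [G1] of the first [b - a] stars, dominate [C(G, f)]. Conversely,
    the leaves q of [G2] and the leaves p of those [b - a] stars of [G1] have
    pairwise disjoint closed neighbourhoods, and there are [b] of them. *)
Require Import Defs.
From mathcomp Require Import all_boot.

Set Implicit Arguments.
Unset Strict Implicit.
Unset Printing Implicit Defensive.

Definition closed_adj (G : sgraph) (u v : G) : bool := (u == v) || edge u v.

Lemma dominatingE (G : sgraph) (D : {set G}) :
  dominating D = [forall v, exists u in D, closed_adj u v].
Proof.
apply: eq_forallb => v; apply/orP/existsP => [[vD|/existsP[u /andP[uD uv]]]|].
- by exists v; rewrite vD /closed_adj eqxx.
- by exists u; rewrite uD /closed_adj uv orbT.
move=> [u /andP[uD /orP[/eqP <-|uv]]]; first by left.
by right; apply/existsP; exists u; rewrite uD.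
Qed.

(** The image of [d] dominates, which bounds the number above. By the second hypothesis no vertex
    dominates two of the [w i], so a dominating set needs a separate vertex for each index. *)
Lemma domination_number_eq (G : sgraph) (I : finType) (d w : I -> G) :
  (forall v, exists i, closed_adj (d i) v) ->
  (forall u i j, closed_adj u (w i) -> closed_adj u (w j) -> i = j) ->
  domination_number G = #|I|.
Proof.
move=> dP wP; have [[D domD eqD] minD] := dominationP G.
apply/eqP; rewrite eqn_leq; apply/andP; split.
  apply: (leq_trans (minD (d @: [set: I]) _)).
    rewrite dominatingE; apply/forallP => v; have [i div] := dP v.
    by apply/existsP; exists (d i); rewrite imset_f // inE.
  by rewrite -cardsT leq_imset_card.
move: domD; rewrite dominatingE => /forallP domD.
have hitD i : exists u, (u \in D) && closed_adj u (w i).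
  by apply/existsP; apply: domD.
(* [h] picks a dominator of [w i] in the minimum set [D]; its injectivity gives the lower bound. *)
pose h i := xchoose (hitD i).
have hP i : (h i \in D) && closed_adj (h i) (w i) := xchooseP (hitD i).
have h_inj : injective h.
  move=> i j eq_h; have /andP[_ hi] := hP i; have /andP[_ hj] := hP j.
  by apply: wP hi _; rewrite eq_h.
rewrite -eqD -(card_codom h_inj); apply/subset_leq_card/subsetP => _ /codomP[i ->].
by have /andP[] := hP i.
Qed.

Section CliqueOfStars.

Variable a : nat.

(* [None] is the centre of a star, [Some true] its leaf p, [Some false] its
   leaf q. *)
Definition star_vertex : finType := ('I_a * option bool)%type.

Definition star_edge : rel star_vertex := fun x y =>
  if x.1 == y.1 then (x.2 == None) (+) (y.2 == None)
  else (x.2 == None) && (y.2 == None).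

Lemma star_edge_sym : symmetric star_edge.
Proof. by move=> x y; rewrite /star_edge eq_sym addbC andbC. Qed.

Lemma star_edge_irr : irreflexive star_edge.
Proof. by move=> x; rewrite /star_edge eqxx addbb. Qed.

Definition star_clique : sgraph := SGraph star_edge_sym star_edge_irr.

Lemma star_clique_connected : 0 < a -> connected_graph star_clique.
Proof.
move=> a_gt0; split; first by apply/card_gt0P; exists (Ordinal a_gt0, None).
have sym : connect_sym (@edge star_clique) by apply/sym_connect_sym/star_edge_sym.
have to_center (x : star_clique) : connect (@edge star_clique) x (x.1, None).
  case: x => i [c|]; last exact: connect0.
  by apply: connect1; rewrite /= /star_edge /= eqxx.
move=> x y; apply: connect_trans (to_center x) _; rewrite sym.
apply: connect_trans (to_center y) _.
have [->|neq_yx] := eqVneq y.1 x.1; first exact: connect0.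
by apply: connect1; rewrite /= /star_edge /= (negPf neq_yx).
Qed.

Definition center (i : 'I_a) : star_clique := (i, None).
Definition leaf (c : bool) (i : 'I_a) : star_clique := (i, Some c).

Lemma center_closed_adj (x : star_clique) : closed_adj (center x.1) x.
Proof.
by case: x => i [c|]; rewrite /closed_adj /= /star_edge /= !eqxx ?orbT.
Qed.

(** A leaf is joined only to its own centre. Hence leaves of different stars have disjoint closed
    neighbourhoods and can play the role of [w]. *)
Lemma closed_adj_leaf (x : star_clique) c i :
  closed_adj x (leaf c i) -> x = center i \/ x = leaf c i.
Proof.
case: x => j [e|]; rewrite /closed_adj /= /star_edge /= ?andbF.
  by rewrite if_same orbF => /eqP; right.
by rewrite xpair_eqE andbF; case: eqP => // ->; left.
Qed.

Lemma domination_star_clique : domination_number star_clique = a.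
Proof.
rewrite -[RHS]card_ord.
apply: (@domination_number_eq _ _ center (leaf true)) => [x|x i j].
  by exists x.1; apply: center_closed_adj.
by move=> /closed_adj_leaf[]-> /closed_adj_leaf[] // [].
Qed.

(** The value p on the first [k] stars cuts them off from the centres of the second copy. No vertex
    is sent to a leaf q, so those leaves gain no neighbour. *)
Definition collapse (k : nat) (x : star_clique) : star_clique :=
  if x.1 < k then leaf true x.1 else center x.1.

Lemma domination_collapse k : k <= a ->
  domination_number (functigraph (collapse k)) = a + k.
Proof.
move=> le_ka; pose W (i : 'I_k) : 'I_a := widen_ord le_ka i.
pose d (t : 'I_a + 'I_k) : functigraph (collapse k) :=
  match t with inl i => inr (center i) | inr i => inl (center (W i)) end.
pose w (t : 'I_a + 'I_k) : functigraph (collapse k) :=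
  match t with
  | inl i => inr (leaf false i)
  | inr i => inl (leaf true (W i))
  end.
have -> : a + k = #|{: 'I_a + 'I_k}| by rewrite card_sum !card_ord.
apply: (@domination_number_eq _ _ d w) => [[x|x]|u].
(* In the first copy, a vertex of a star sent to p is dominated by its own centre, any other one by
   its image, a centre of the second copy. *)
- have [lt_xk|ge_xk] := ltnP x.1 k.
    exists (inr (Ordinal lt_xk)); rewrite /d.
    have -> : W (Ordinal lt_xk) = x.1 by apply: val_inj.
    exact: center_closed_adj.
  by exists (inl x.1); rewrite /closed_adj /= /collapse ltnNge ge_xk /= eqxx.
- by exists (inl x.1); apply: center_closed_adj.
have adj_inl i : closed_adj u (w (inl i)) ->
    u = inr (center i) \/ u = inr (leaf false i).
  case: u => x /=.
    by rewrite /closed_adj /= /collapse; case: ifP => _ /= /eqP.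
  by move=> /(@closed_adj_leaf x)[]->; [left|right].
have adj_inr i : closed_adj u (w (inr i)) -> exists2 x : star_clique,
    x.1 = W i & u = inl x \/ u = inr (leaf true (W i)).
  case: u {adj_inl} => x.
    by move=> /(@closed_adj_leaf x) xE; exists x; [case: xE => -> | left].
  (* Here [u] lies in the second copy, so it is the image of the leaf, and [x] is only a placeholder
     in the right star. *)
  by rewrite /closed_adj /= /collapse /= ltn_ord => /eqP->; exists (center (W i)); [|right].
move=> [i|i] [j|j].
- move=> /adj_inl uE /adj_inl uE'; congr inl.
  by case: uE uE' => -> [] // [].
- by move=> /adj_inl uE /adj_inr[y _]; case: uE => -> [].
- by move=> /adj_inr[y _ uE] /adj_inl; case: uE => -> [].
move=> /adj_inr[x xi uE] /adj_inr[y yj uE']; congr inr; apply: val_inj.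
have: W i = W j; last by move/(congr1 val).
case: uE uE' => -> [] //; first by move=> [xy]; rewrite -xi -yj xy.
by move=> [ij]; apply: val_inj.
Qed.

End CliqueOfStars.

Theorem theorem2p2 (a b : nat) (ha : 1 <= a) (hab : a <= b) (hb : b <= 2 * a) :
  exists (G : sgraph) (f : G -> G),
    [/\ connected_graph G,
        domination_number G = a
      & domination_number (functigraph f) = b].
Proof.
exists (star_clique a), (@collapse a (b - a)); split.
- exact: star_clique_connected.
- exact: domination_star_clique.
(* The hypothesis [hb] says that there are at least [b - a] stars to collapse. *)
by rewrite domination_collapse ?subnKC // leq_subLR addnn -mul2n.
Qed.
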